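(* For each natural number $3\le n\le 6$, the $\mathbf{B}_n$-representation $\widetilde{\mathbf{LM}}_q(\eta_n)\colon\mathbf{B}_n\to\mathrm{GL}_{n(n-1)}(\mathbb{Z}[t^{\pm1},q^{\pm1}])$ is absolutely irreducible.
   Context: $\mathbf{B}_n$ is the braid group with Artin generators $\sigma_1,\dots,\sigma_{n-1}$, and $\mathbf{F}_n=\langle x_1,\dots,x_n\rangle$ is the free group. Let $A=\mathbb{Z}[t^{\pm1},q^{\pm1}]$. The Artin homomorphism $a_n\colon\mathbf{B}_n\to\mathrm{Aut}(\mathbf{F}_n)$ is given by $a_n(\sigma_i)(x_i)=x_{i+1}$, $a_n(\sigma_i)(x_{i+1})=x_{i+1}^{-1}x_ix_{i+1}$, $a_n(\sigma_i)(x_j)=x_j$ for $j\notin\{i,i+1\}$. The Tong-Yang-Ma representation is $TYM_n(\sigma_i)=I_{i-1}\oplus\begin{pmatrix}0&1\\t&0\end{pmatrix}\oplus I_{n-i-1}$. The representation $\eta_n\colon\mathbf{F}_n\rtimes_{a_n}\mathbf{B}_n\to\mathrm{GL}_n(A)$ is given by $\eta_n(\sigma_i)=TYM_n(\sigma_i)$ and $\eta_n(x_i)=q^2\,\mathrm{Diag}(1,\dots,1,t,1,\dots,1)$ with $t$ in position $i$. Long-Moody representation: $\mathbf{LM}_q(\eta_n)$ is the $\mathbf{B}_n$-module $\mathcal{I}_{\mathbf{F}_n}\otimes_{\mathbb{Z}[\mathbf{F}_n]}A^n$, where $\mathcal{I}_{\mathbf{F}_n}\subset\mathbb{Z}[\mathbf{F}_n]$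 is the augmentation ideal, $A^n$ is an $\mathbf{F}_n$-module via $\eta_n$, and $\sigma\in\mathbf{B}_n$ acts by $\sigma(y\otimes v)=a_n(\sigma)(y)\otimes\eta_n(\sigma)(v)$. The reduced version $\widetilde{\mathbf{LM}}_q(\eta_n)$ is its quotient by the subrepresentation $(x_1x_2\cdots x_n-1)\otimes A^n$. Explicitly, on $(A^n)^{\oplus(n-1)}$ written in $n\times n$ blocks (the $k$-th summand corresponding to $(x_1\cdots x_k-1)\otimes A^n$), $\sigma_i$ acts by the block matrix whose $(j,j)$ block is $TYM_n(\sigma_i)$ for $j\neq i$, whose $i$-th block column has $\eta_n(x_{i+1})TYM_n(\sigma_i)$ in row $i-1$ (if $i\ge2$), $-\eta_n(x_{i+1})TYM_n(\sigma_i)$ in row $i$, and $TYM_n(\sigma_i)$ in row $i+1$ (if $i\le n-2$), and whose other blocks are $0$. For a group $G$ and an integral domain $R$ with field of fractions $K$ and algebraic closure $\bar K$, a representation $\rho\colon G\to\mathrm{GL}_m(R)$ is absolutely irreducible if $\rho\otimes_R\bar K$ is irreducible. *)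

(* Defs.v *)
From HB Require Import structures.
From mathcomp Require Import all_boot all_order all_algebra.
From mathcomp Require Import boolp.
From mathcomp Require Import zify ring.

Set Implicit Arguments.
Unset Strict Implicit.
Unset Printing Implicit Defensive.

Import GRing.Theory.
Local Open Scope ring_scope.
Local Open Scope quotient_scope.

(* The letter [(x, true)] stands for the generator x, [(x, false)] for its
   inverse. *)
Definition word (X : Type) := seq (X * bool).

Section PresentedGroup.
Variables (X : choiceType) (rel : word X -> word X -> Prop).

Inductive pres_eq : word X -> word X -> Prop :=
  | PresRel u v : rel u v -> pres_eq u v
  | PresCancel x b : pres_eq [:: (x, b); (x, ~~ b)] [::]
  | PresRefl u : pres_eq u u
  | PresSym u v : pres_eq u v -> pres_eq v u
  | PresTrans u v w : pres_eq u v -> pres_eq v w -> pres_eq u w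
  | PresCat u u' v v' : pres_eq u u' -> pres_eq v v' ->
      pres_eq (u ++ v) (u' ++ v').

Definition pres_eqb (u v : word X) : bool := `[< pres_eq u v >].

Lemma pres_eqb_refl : reflexive pres_eqb.
Proof. by move=> u; apply/asboolP; exact: PresRefl. Qed.

Lemma pres_eqb_sym : symmetric pres_eqb.
Proof. by move=> u v; apply/asboolP/asboolP; exact: PresSym. Qed.

Lemma pres_eqb_trans : transitive pres_eqb.
Proof.
by move=> v u w /asboolP uv /asboolP vw; apply/asboolP; exact: PresTrans uv vw.
Qed.

Canonical pres_equiv :=
  EquivRel pres_eqb pres_eqb_refl pres_eqb_sym pres_eqb_trans.

Definition pres_group := {eq_quot pres_equiv}.

HB.instance Definition _ := Choice.on pres_group.
HB.instance Definition _ := EqQuotient.on pres_group.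

Definition class_of (u : word X) : pres_group := \pi_pres_group u.

Lemma class_ofP u v : class_of u = class_of v <-> pres_eq u v.
Proof.
by rewrite /class_of; split=> [/eqquotP/asboolP //|h]; apply/eqquotP/asboolP.
Qed.

Lemma class_ofK (g : pres_group) : class_of (repr g) = g.
Proof. exact: reprK. Qed.

Definition inv_word (u : word X) : word X :=
  rev [seq (xb.1, ~~ xb.2) | xb <- u].

Lemma pres_eq_mulV u : pres_eq (u ++ inv_word u) [::].
Proof.
elim: u => [|[x b] u IH]; first exact: PresRefl.
rewrite /inv_word /= rev_cons -cats1 -cat1s.
have -> : [:: (x, b)] ++ u ++ rev [seq (xb.1, ~~ xb.2) | xb <- u]
            ++ [:: (x, ~~ b)] =
          [:: (x, b)] ++ (u ++ inv_word u) ++ [:: (x, ~~ b)].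
  by rewrite /inv_word !catA.
apply: PresTrans (PresCancel x b).
apply: (@PresCat [:: (x, b)] [:: (x, b)] _ [:: (x, ~~ b)]).
  exact: PresRefl.
apply: (@PresCat _ [::] [:: (x, ~~ b)] [:: (x, ~~ b)]) => //.
exact: PresRefl.
Qed.

Lemma inv_wordK : involutive inv_word.
Proof.
move=> u; rewrite /inv_word map_rev revK -map_comp map_id_in //.
by case=> x b _ /=; rewrite negbK.
Qed.

Lemma pres_eq_mulVw u : pres_eq (inv_word u ++ u) [::].
Proof. by have := pres_eq_mulV (inv_word u); rewrite inv_wordK. Qed.

Lemma pres_eq_inv u v : pres_eq u v -> pres_eq (inv_word u) (inv_word v).
Proof.
move=> uv.
have h1 : pres_eq (inv_word u ++ (v ++ inv_word v)) (inv_word u).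
  rewrite -[X in pres_eq _ X]cats0.
  by apply: PresCat; [exact: PresRefl|exact: pres_eq_mulV].
apply: PresTrans (PresSym h1) _; rewrite catA.
apply: (@PresTrans _ (inv_word u ++ u ++ inv_word v)).
  rewrite -catA; apply: PresCat; first exact: PresRefl.
  by apply: PresCat; [exact: PresSym|exact: PresRefl].
rewrite catA -[X in pres_eq _ X]cat0s.
by apply: PresCat; [exact: pres_eq_mulVw|exact: PresRefl].
Qed.

Definition pres_one : pres_group := class_of [::].
Definition pres_mul (g h : pres_group) : pres_group :=
  class_of (repr g ++ repr h).
Definition pres_inv (g : pres_group) : pres_group :=
  class_of (inv_word (repr g)).

Lemma pres_eq_repr u : pres_eq (repr (class_of u)) u.
Proof. by apply/class_ofP; rewrite class_ofK. Qed.

Lemma class_of_cat u v : pres_mul (class_of u) (class_of v) = class_of (u ++ v).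
Proof. by apply/class_ofP; apply: PresCat; apply: pres_eq_repr. Qed.

Lemma class_of_inv u : pres_inv (class_of u) = class_of (inv_word u).
Proof. by apply/class_ofP; apply: pres_eq_inv; apply: pres_eq_repr. Qed.

Lemma pres_mulA : associative pres_mul.
Proof.
move=> g h k; rewrite -(class_ofK g) -(class_ofK h) -(class_ofK k).
by rewrite !class_of_cat catA.
Qed.

Lemma pres_mul1g : left_id pres_one pres_mul.
Proof. by move=> g; rewrite -(class_ofK g) class_of_cat. Qed.

Lemma pres_mulg1 : right_id pres_one pres_mul.
Proof. by move=> g; rewrite -(class_ofK g) class_of_cat cats0. Qed.

Lemma pres_mulVg : left_inverse pres_one pres_inv pres_mul.
Proof.
move=> g; rewrite -(class_ofK g) class_of_inv class_of_cat.
by apply/class_ofP; exact: pres_eq_mulVw.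
Qed.

Lemma pres_mulgV : right_inverse pres_one pres_inv pres_mul.
Proof.
move=> g; rewrite -(class_ofK g) class_of_inv class_of_cat.
by apply/class_ofP; exact: pres_eq_mulV.
Qed.

HB.instance Definition _ := isGroup.Build pres_group
  pres_mulA pres_mul1g pres_mulg1 pres_mulVg pres_mulgV.

Definition pres_gen (x : X) : pres_group := class_of [:: (x, true)].

Section Lift.
Variables (H : groupType) (f : X -> H).

Definition eval_word (u : word X) : H :=
  foldr (fun xb h => ((if xb.2 then f xb.1 else (f xb.1)^-1) * h)%g) 1%g u.

Lemma eval_word_cat u v : eval_word (u ++ v) = (eval_word u * eval_word v)%g.
Proof. by elim: u => [|x u IH] /=; rewrite ?mul1g // IH mulgA. Qed.

Hypothesis f_rel : forall u v, rel u v -> eval_word u = eval_word v.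

Lemma eval_word_pres_eq u v : pres_eq u v -> eval_word u = eval_word v.
Proof.
elim=> {u v} //.
- by move=> x [] /=; rewrite mulg1 ?mulgV ?mulVg.
- by move=> u v w _ -> _ ->.
- by move=> u u' v v' _ IHu _ IHv; rewrite !eval_word_cat IHu IHv.
Qed.

Definition pres_lift_fun (g : pres_group) : H := eval_word (repr g).

Lemma pres_lift_class u : pres_lift_fun (class_of u) = eval_word u.
Proof. exact/eval_word_pres_eq/pres_eq_repr. Qed.

Lemma pres_lift_morph : {morph pres_lift_fun : g h / (g * h)%g}.
Proof.
move=> g h; rewrite -(class_ofK g) -(class_ofK h).
by rewrite [(_ * _)%g]class_of_cat !pres_lift_class eval_word_cat.
Qed.

HB.instance Definition _ := isMultiplicative.Build _ _ _ pres_lift_morph.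

Definition pres_lift : {multiplicative pres_group -> H} := pres_lift_fun.

Lemma pres_lift_gen x : pres_lift (pres_gen x) = f x.
Proof. by rewrite /pres_lift /= pres_lift_class /= mulg1. Qed.

End Lift.
End PresentedGroup.

(* Indices start at 0: [i : 'I_n.-1] stands for the Artin generator
   sigma_(i+1). *)
Variant braid_rel (n : nat) : word 'I_n.-1 -> word 'I_n.-1 -> Prop :=
  | BraidRel (i j : 'I_n.-1) : j = i.+1 :> nat ->
      braid_rel [:: (i, true); (j, true); (i, true)]
                [:: (j, true); (i, true); (j, true)]
  | BraidComm (i j : 'I_n.-1) : (i.+1 < j)%N ->
      braid_rel [:: (i, true); (j, true)] [:: (j, true); (i, true)].

Definition braid_group (n : nat) : groupType := pres_group (@braid_rel n).
Definition artin (n : nat) (i : 'I_n.-1) : braid_group n :=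
  pres_gen (@braid_rel n) i.

Section GL.
Variables (R : comUnitRingType) (m : nat).

Record GL := MkGL { GLmx :> 'M[R]_m; _ : GLmx \in unitmx }.

HB.instance Definition _ := [isSub for GLmx].
HB.instance Definition _ := [Choice of GL by <:].

Lemma GL_unit (A : GL) : (A : 'M_m) \in unitmx. Proof. by case: A. Qed.

Lemma GL_mul_subproof (A B : GL) : A *m B \in unitmx.
Proof. by rewrite unitmx_mul !GL_unit. Qed.

Lemma GL_inv_subproof (A : GL) : invmx A \in unitmx.
Proof. by rewrite unitmx_inv GL_unit. Qed.

Definition GL_one : GL := MkGL (unitmx1 R m).
Definition GL_mul (A B : GL) : GL := MkGL (GL_mul_subproof A B).
Definition GL_inv (A : GL) : GL := MkGL (GL_inv_subproof A).

Lemma GL_mulA : associative GL_mul.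
Proof. by move=> A B C; apply: val_inj; rewrite /= mulmxA. Qed.
Lemma GL_mul1g : left_id GL_one GL_mul.
Proof. by move=> A; apply: val_inj; rewrite /= mul1mx. Qed.
Lemma GL_mulg1 : right_id GL_one GL_mul.
Proof. by move=> A; apply: val_inj; rewrite /= mulmx1. Qed.
Lemma GL_mulVg : left_inverse GL_one GL_inv GL_mul.
Proof. by move=> A; apply: val_inj; rewrite /= mulVmx ?GL_unit. Qed.
Lemma GL_mulgV : right_inverse GL_one GL_inv GL_mul.
Proof. by move=> A; apply: val_inj; rewrite /= mulmxV ?GL_unit. Qed.

HB.instance Definition _ :=
  isGroup.Build GL GL_mulA GL_mul1g GL_mulg1 GL_mulVg GL_mulgV.

End GL.

Section MapGL.
Variables (R S : comUnitRingType) (f : {rmorphism R -> S}) (m : nat).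

Lemma map_GL_subproof (A : GL R m) : map_mx f A \in unitmx.
Proof. by rewrite unitmxE det_map_mx rmorph_unit // -unitmxE GL_unit. Qed.

Definition map_GL (A : GL R m) : GL S m := MkGL (map_GL_subproof A).

Lemma map_GL_morph : {morph map_GL : A B / (A * B)%g}.
Proof. by move=> A B; apply: val_inj; rewrite /= map_mxM. Qed.

HB.instance Definition _ := isMultiplicative.Build _ _ _ map_GL_morph.

End MapGL.

Definition representation (G : groupType) (R : comUnitRingType) (m : nat) :=
  {multiplicative G -> GL R m}.

Definition base_change (R S : comUnitRingType) (f : {rmorphism R -> S})
    (G : groupType) (m : nat) (rho : representation G R m) :
    representation G S m :=
  map_GL f (m := m) \o rho.

Definition irreducible_rep (G : groupType) (F : fieldType) (m : nat)
    (rho : representation G F m) : Prop :=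
  (0 < m)%N /\
  forall W : {vspace 'cV[F]_m},
    (forall (g : G) (w : 'cV[F]_m), w \in W -> rho g *m w \in W) ->
    W = 0%VS \/ W = fullv.

(* [L], equipped with [iota], ranges over the algebraic closures of the field
   of fractions of R. *)
Definition absolutely_irreducible (G : groupType) (R : idomainType) (m : nat)
    (rho : representation G R m) : Prop :=
  forall (L : closedFieldType) (iota : {rmorphism {fraction R} -> L}),
    integralRange iota ->
    irreducible_rep (base_change (iota \o @tofrac R) rho).

(* Realised inside Frac(Z[t][q]): in {poly {poly int}}, t is the inner
   variable and q the outer one. *)
Definition Zq_t_frac := {fraction {poly {poly int}}}.

Definition frac_t : Zq_t_frac := tofrac 'X%:P.
Definition frac_q : Zq_t_frac := tofrac 'X.

Definition is_laurent (x : Zq_t_frac) : bool :=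
  `[< exists (p : {poly {poly int}}) (a b : nat),
        x = tofrac p / (frac_t ^+ a * frac_q ^+ b) >].

Lemma frac_t_neq0 : frac_t != 0.
Proof. by rewrite tofrac_eq0 polyC_eq0 polyX_eq0. Qed.

Lemma frac_q_neq0 : frac_q != 0.
Proof. by rewrite tofrac_eq0 polyX_eq0. Qed.

Lemma is_laurentP x :
  reflect (exists (p : {poly {poly int}}) (a b : nat),
             x = tofrac p / (frac_t ^+ a * frac_q ^+ b)) (x \in is_laurent).
Proof. exact: asboolP. Qed.

Lemma frac_subE (F : fieldType) (t q u u' : F) a b a' b' : t != 0 -> q != 0 ->
  u / (t ^+ a * q ^+ b) - u' / (t ^+ a' * q ^+ b') =
  (u * (t ^+ a' * q ^+ b') - u' * (t ^+ a * q ^+ b)) /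
    (t ^+ (a + a') * q ^+ (b + b')).
Proof. by move=> t0 q0; rewrite !exprD; field; rewrite ?expf_neq0 ?t0 ?q0. Qed.

Lemma frac_mulE (F : fieldType) (t q u u' : F) a b a' b' : t != 0 -> q != 0 ->
  u / (t ^+ a * q ^+ b) * (u' / (t ^+ a' * q ^+ b')) =
  (u * u') / (t ^+ (a + a') * q ^+ (b + b')).
Proof. by move=> t0 q0; rewrite !exprD; field; rewrite ?expf_neq0 ?t0 ?q0. Qed.

Lemma laurent_subring_closed : subring_closed is_laurent.
Proof.
split.
- apply/is_laurentP; exists 1, 0%N, 0%N.
  by rewrite tofrac1 !expr0 mulr1 divr1.
- move=> _ _ /is_laurentP[p [a [b ->]]] /is_laurentP[p' [a' [b' ->]]].
  apply/is_laurentP.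
  exists (p * ('X%:P ^+ a' * 'X ^+ b') - p' * ('X%:P ^+ a * 'X ^+ b)).
  exists (a + a')%N, (b + b')%N.
  rewrite (frac_subE _ _ _ _ _ _ frac_t_neq0 frac_q_neq0).
  by rewrite tofracB !tofracM !tofracXn.
- move=> _ _ /is_laurentP[p [a [b ->]]] /is_laurentP[p' [a' [b' ->]]].
  apply/is_laurentP; exists (p * p'), (a + a')%N, (b + b')%N.
  by rewrite (frac_mulE _ _ _ _ _ _ frac_t_neq0 frac_q_neq0) tofracM.
Qed.

HB.instance Definition _ :=
  GRing.isSubringClosed.Build Zq_t_frac is_laurent laurent_subring_closed.

Record laurent := MkLaurent { laurent_val :> Zq_t_frac; _ : is_laurent laurent_val }.

HB.instance Definition _ := [isSub for laurent_val].
HB.instance Definition _ := [Choice of laurent by <:].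
HB.instance Definition _ := [SubChoice_isSubComNzRing of laurent by <:].

Definition laurent_unit (x : laurent) : bool :=
  (val x != 0) && is_laurent (val x)^-1.
Definition laurent_inv (x : laurent) : laurent :=
  if laurent_unit x then insubd x (val x)^-1 else x.

Lemma laurent_mulVx : {in laurent_unit, left_inverse 1 laurent_inv *%R}.
Proof.
move=> x xU; rewrite /laurent_inv (xU : laurent_unit x).
case/andP: xU => x0 xV; apply: val_inj.
by rewrite rmorphM rmorph1 /= /insubd insubT /= mulVf.
Qed.

Lemma laurent_unitPl (x y : laurent) : y * x = 1 -> laurent_unit x.
Proof.
move=> yx; have yx1 : val y * val x = 1 by rewrite -rmorphM yx rmorph1.
have x0 : val x != 0.
  by apply/eqP => x0; move/eqP: yx1; rewrite x0 mulr0 eq_sym oner_eq0.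
rewrite /laurent_unit x0 /=.
have -> : (val x)^-1 = val y by rewrite -[RHS](mulfK x0) yx1 mul1r.
exact: valP.
Qed.

Lemma laurent_inv_out : {in [predC laurent_unit], laurent_inv =1 id}.
Proof. by move=> x xU; rewrite /laurent_inv ifN. Qed.

HB.instance Definition _ := GRing.ComNzRing_hasMulInverse.Build laurent
  laurent_mulVx laurent_unitPl laurent_inv_out.

Lemma laurent_idomain : GRing.integral_domain_axiom laurent.
Proof.
move=> x y /(congr1 val); rewrite rmorphM rmorph0 => /eqP.
by rewrite mulf_eq0 -!(inj_eq val_inj) !rmorph0.
Qed.

HB.instance Definition _ :=
  GRing.ComUnitRing_isIntegral.Build laurent laurent_idomain.

Lemma frac_t_laurent : is_laurent frac_t.
Proof. by apply/asboolP; exists 'X%:P, 0%N, 0%N; rewrite !expr0 mul1r divr1. Qed.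

Lemma frac_q_laurent : is_laurent frac_q.
Proof. by apply/asboolP; exists 'X, 0%N, 0%N; rewrite !expr0 mul1r divr1. Qed.

Definition laurent_t : laurent := MkLaurent frac_t_laurent.
Definition laurent_q : laurent := MkLaurent frac_q_laurent.

Lemma laurent_t_unit : laurent_t \is a GRing.unit.
Proof.
apply/andP; split; first exact: frac_t_neq0.
by apply/asboolP; exists 1, 1%N, 0%N; rewrite tofrac1 mulr1 mul1r.
Qed.

Lemma laurent_q_unit : laurent_q \is a GRing.unit.
Proof.
apply/andP; split; first exact: frac_q_neq0.
by apply/asboolP; exists 1, 0%N, 1%N; rewrite tofrac1 !mul1r.
Qed.

Lemma strand_lt (n : nat) (i : 'I_n.-1) : (i.+1 < n)%N.
Proof. by case: n i => [|n] [i] //=. Qed.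

Definition strandS (n : nat) (i : 'I_n.-1) : 'I_n := Ordinal (strand_lt i).

(* eta_n(sigma_i) *)
Definition TYM (n : nat) (i : 'I_n.-1) : 'M[laurent]_n :=
  \matrix_(a, b)
    if (a == i :> nat) && (b == i.+1 :> nat) then 1
    else if (a == i.+1 :> nat) && (b == i :> nat) then laurent_t
    else ((a == b) && (a != i :> nat) && (a != i.+1 :> nat))%:R.

(* eta_n(x_j) *)
Definition eta_x (n : nat) (j : 'I_n) : 'M[laurent]_n :=
  laurent_q ^+ 2 *: diag_mx (\row_k if k == j then laurent_t else 1).

(* The c-th summand of (A^n)^(n-1), counted from c = 0, is
   (x_1 ... x_(c+1) - 1) (x) A^n. The column c = i is the image of
   (y x_i - 1) (x) v, with y = x_1 ... x_(i-1) in 1-based notation: as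
   a_n(sigma_i)(y x_i) = y x_(i+1), it equals
     (y x_(i+1) - 1) (x) w
       = (y - 1) (x) x_(i+1) w - (y x_i - 1) (x) x_(i+1) w
         + (y x_i x_(i+1) - 1) (x) w,     w = eta_n(sigma_i) v;
   the first term is absent for i = 1, and the last one is zero in the reduced
   module for i = n - 1. *)
Definition rLM_block (n : nat) (i r c : 'I_n.-1) : 'M[laurent]_n :=
  if c == i then
    if r.+1 == i :> nat then eta_x (strandS i) *m TYM i
    else if r == i then - (eta_x (strandS i) *m TYM i)
    else if r == i.+1 :> nat then TYM i
    else 0
  else if r == c then TYM i else 0.

Definition rLM_dim (n : nat) : nat := (\sum_(k < n.-1) n)%N.

Lemma rLM_dimE (n : nat) : rLM_dim n = (n * (n - 1))%N.
Proof. by rewrite /rLM_dim sum_nat_const card_ord mulnC subn1. Qed.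

Definition rLM_gen (n : nat) (i : 'I_n.-1) : 'M[laurent]_(rLM_dim n) :=
  \mxblock_(r < n.-1, c < n.-1) rLM_block i r c.

Section RLMUnit.
Variables (n : nat) (i : 'I_n.-1).

Lemma rLM_block_mul m (F : 'I_n.-1 -> 'M[laurent]_(n, m)) r :
  \sum_k rLM_block i r k *m F k =
  (if r == i then 0 else TYM i *m F r) +
  (if r.+1 == i :> nat then eta_x (strandS i) *m (TYM i *m F i)
   else if r == i then - (eta_x (strandS i) *m (TYM i *m F i))
   else if r == i.+1 :> nat then TYM i *m F i else 0).
Proof.
rewrite (bigD1 i) //= addrC; congr (_ + _).
  have [-> | ri] := eqVneq r i.
    by apply: big1 => k /negPf ki; rewrite /rLM_block ki eq_sym ki mul0mx.
  rewrite (bigD1 r) //= big1 ?addr0 => [|k /andP[/negPf ki /negPf kr]].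
    by rewrite /rLM_block (negPf ri) eqxx.
  by rewrite /rLM_block ki eq_sym kr mul0mx.
rewrite /rLM_block eqxx.
by do ![case: ifP => _]; rewrite ?mulNmx ?mulmxA ?mul0mx.
Qed.

Lemma TYM_mulE m (M : 'M[laurent]_(n, m)) a b :
  (TYM i *m M) a b =
  if a == i :> nat then M (strandS i) b
  else if a == i.+1 :> nat then laurent_t * M (widen_ord (leq_pred n) i) b
  else M a b.
Proof.
rewrite mxE; case: ifP => [/eqP ai | /negP ai].
  rewrite (bigD1 (strandS i)) //= big1 => [|k kS].
    by rewrite !mxE ai !eqxx mul1r addr0.
  rewrite !mxE ai eqxx /= -(inj_eq val_inj) /= in kS *.
  by rewrite (negPf kS) (ltn_eqF (ltnSn i)) andbF mul0r.
case: ifP => [/eqP aS | /negP aS].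
  rewrite (bigD1 (widen_ord (leq_pred n) i)) //= big1 => [|k ki].
    by rewrite !mxE aS /= !eqxx andbT (gtn_eqF (ltnSn i)) /= addr0.
  rewrite !mxE aS -(inj_eq val_inj) /= in ki *.
  by rewrite (negPf ki) eqxx (gtn_eqF (ltnSn i)) /= andbF mul0r.
rewrite (bigD1 a) //= big1 => [|k ka].
  by rewrite !mxE (introF idP ai) (introF idP aS) eqxx /= mul1r addr0.
rewrite !mxE (introF idP ai) (introF idP aS) /= eq_sym.
by rewrite (negPf ka) mul0r.
Qed.

Lemma eta_x_mulE (j : 'I_n) m (M : 'M[laurent]_(n, m)) a b :
  (eta_x j *m M) a b = laurent_q ^+ 2 * (if a == j then laurent_t else 1) * M a b.
Proof. by rewrite -scalemxAl mxE mul_diag_mx !mxE mulrA. Qed.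

Lemma TYM_unit : TYM i \in unitmx.
Proof.
pose D : 'M[laurent]_n :=
  \matrix_(a, b) if a == b then
    (if (a == i :> nat) || (a == i.+1 :> nat) then laurent_t^-1 else 1) else 0.
suff /mulmx1_unit[] : TYM i *m (TYM i *m D) = 1%:M by [].
apply/matrixP => a b; rewrite TYM_mulE !TYM_mulE !mxE -!(inj_eq val_inj) /=.
rewrite !eqxx (gtn_eqF (ltnSn i)) /=.
case: ifP => [/eqP ->|ai].
  by case: ifP => _; rewrite ?mulr0 // divrr ?laurent_t_unit.
case: ifP => [/eqP ->|aS]; last by rewrite ?ai ?aS /=; case: (_ == _).
by case: ifP => _; rewrite ?mulr0 // divrr ?laurent_t_unit.
Qed.

Lemma eta_x_unit (j : 'I_n) : eta_x j \in unitmx.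
Proof.
pose D : 'M[laurent]_n :=
  \matrix_(a, b) if a == b then
    laurent_q ^- 2 * (if a == j then laurent_t^-1 else 1) else 0.
suff /mulmx1_unit[] : eta_x j *m D = 1%:M by [].
apply/matrixP => a b; rewrite eta_x_mulE !mxE.
case: (a == b); last by rewrite mulr0.
rewrite mulrACA divrr ?unitrX ?laurent_q_unit // mul1r.
by case: ifP => _; rewrite ?mulr1 // divrr ?laurent_t_unit.
Qed.

Lemma rLM_gen_unit : rLM_gen i \in unitmx.
Proof.
set X := eta_x (strandS i); set T := TYM i.
pose G (k c : 'I_n.-1) : 'M[laurent]_n :=
  (if k == i then 0 else (k == c)%:R%:M) +
  (if c == i then
     if k.+1 == i :> nat then 1%:M
     else if k == i then - invmx X
     else if k == i.+1 :> nat then invmx X else 0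
   else 0).
pose B : 'M[laurent]_(rLM_dim n) :=
  \mxblock_(k < n.-1, c < n.-1) (invmx T *m G k c).
suff /mulmx1_unit[] : rLM_gen i *m B = 1%:M by [].
rewrite /rLM_gen /B mul_mxblock.
transitivity (\mxblock_(r < n.-1, c < n.-1) ((r == c)%:R%:M : 'M[laurent]_n)).
  apply: eq_mxblock => r c /=; rewrite rLM_block_mul -/T -/X.
  have XU : X \in unitmx := eta_x_unit _.
  have Si : (i.+1 == i :> nat) = false by rewrite gtn_eqF.
  rewrite !(mulKVmx TYM_unit) /G eqxx.
  have [-> | ri] := eqVneq r i.
    rewrite Si !add0r [c == i]eq_sym.
    case: (i == c); last by rewrite mulmx0 oppr0 raddf0.
    by rewrite mulmxN opprK mulmxV.
  rewrite Si !add0r.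
  have [ci | ci] := eqVneq c i; last first.
    by do ![case: ifP => _]; rewrite ?mulmx0 !addr0.
  rewrite mulmxN mulmxV //; case: ifP => _; first by rewrite addrK.
  by case: ifP => _; rewrite ?addr0 ?addrK.
rewrite -mxdiagZ /mxdiag; apply: eq_mxblock => r c.
by case: (r == c); rewrite ?conform_mx_id //= raddf0.
Qed.

End RLMUnit.


(* The same operators on families indexed by a block r and a coordinate a. *)
Section RLMBraid.

Let f2 := nat -> nat -> laurent.

Let tymf (i : nat) (f : nat -> laurent) (a : nat) : laurent :=
  if a == i then f i.+1 else if a == i.+1 then laurent_t * f i else f a.

Let xf (i : nat) (f : nat -> laurent) (a : nat) : laurent :=
  laurent_q ^+ 2 * (if a == i.+1 then laurent_t else 1) * f a.

Let rLMf (i : nat) (w : f2) (r a : nat) : laurent :=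
  (if r == i then 0 else tymf i (w r) a) +
  (if r.+1 == i then xf i (tymf i (w i)) a
   else if r == i then - xf i (tymf i (w i)) a
   else if r == i.+1 then tymf i (w i) a else 0).

Let rLMf_braid i w r a :
  rLMf i (rLMf i.+1 (rLMf i w)) r a = rLMf i.+1 (rLMf i (rLMf i.+1 w)) r a.
Proof.
have E0 k : (k == k.+1) = false by lia.
have E1 k : (k.+1 == k) = false by lia.
have E2 k : (k == k.+2) = false by lia.
have E3 k : (k.+2 == k) = false by lia.
have E4 k : (k == k.+3) = false by lia.
have E5 k : (k.+3 == k) = false by lia.
have E := (eqxx, eqSS, E0, E1, E2, E3, E4, E5).
rewrite /rLMf /tymf /xf.
case: (eqVneq r i) => [? | /negPf r0];
  last case: (eqVneq r i.+1) => [? | /negPf r1];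
  last case: (eqVneq r.+1 i) => [? | /negPf r2];
  last case: (eqVneq r i.+2) => [? | /negPf r3].
all: case: (eqVneq a i) => [? | /negPf a0];
  last case: (eqVneq a i.+1) => [? | /negPf a1];
  last case: (eqVneq a i.+2) => [? | /negPf a2].
all: subst; rewrite ?E ?r0 ?r1 ?r2 ?r3 ?a0 ?a1 ?a2 /=; ring.
Qed.

Let rLMf_comm i j w r a : (i.+1 < j)%N ->
  rLMf i (rLMf j w) r a = rLMf j (rLMf i w) r a.
Proof.
move=> ij; rewrite /rLMf /tymf /xf.
have [d ->] : exists d, j = (i + d).+2 by exists (j - i.+2)%N; lia.
move: ij => _.
case: (eqVneq r i) => r0; last case: (eqVneq r i.+1) => r1;
  last case: (eqVneq r.+1 i) => r2; last case: (eqVneq r (i + d).+2) => r3;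
  last case: (eqVneq r.+1 (i + d).+2) => r4;
  last case: (eqVneq r (i + d).+3) => r5.
all: case: (eqVneq a i) => a0; last case: (eqVneq a i.+1) => a1;
  last case: (eqVneq a (i + d).+2) => a2;
  last case: (eqVneq a (i + d).+3) => a3.
all: repeat match goal with
  | |- context [@eq_op _ ?x ?y] =>
      first [ rewrite (_ : (x == y) = true); last by lia
            | rewrite (_ : (x == y) = false); last by lia
            | case: (eqVneq x y) => ? ]
  end.
all: subst; rewrite /=; ring.
Qed.

Variables (n m : nat).

Let frep (M : 'M[laurent]_(rLM_dim n, m)) (b : 'I_m) (w : f2) :=
  forall (r : 'I_n.-1) (a : 'I_n), submxcol M r a b = w r a.

Let frep_ex M b : exists w, frep M b w.
Proof.
exists (fun r a => if (insub r, insub a) is (Some r', Some a')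
                   then submxcol M r' a' b else 0).
by move=> r a; rewrite !valK.
Qed.

Let frep_gen i M b w : frep M b w -> frep (rLM_gen i *m M) b (rLMf i w).
Proof.
move=> Mw r a; rewrite -[M in LHS]submxcolK /rLM_gen mul_mxblock_mxrow mxcolK.
rewrite rLM_block_mul mxE /rLMf -(inj_eq val_inj) /=.
have tyE k : (TYM i *m submxcol M k) a b = tymf i (w k) a.
  by rewrite TYM_mulE /tymf !Mw.
have xE : (eta_x (strandS i) *m (TYM i *m submxcol M i)) a b =
    xf i (tymf i (w i)) a.
  by rewrite eta_x_mulE tyE /xf -(inj_eq val_inj).
congr (_ + _); first by case: ifP => _; [rewrite mxE | exact: tyE].
case: ifP => _; first exact: xE.
case: ifP => _; first by rewrite mxE xE.
by case: ifP => _; [exact: tyE | rewrite mxE].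
Qed.

Lemma rLM_gen_braid_mul (i j : 'I_n.-1) (M : 'M[laurent]_(rLM_dim n, m)) :
  j = i.+1 :> nat ->
  rLM_gen i *m (rLM_gen j *m (rLM_gen i *m M)) =
  rLM_gen j *m (rLM_gen i *m (rLM_gen j *m M)).
Proof.
move=> ji; apply/mxcolP => r; apply/matrixP => a b.
have [w Mw] := frep_ex M b.
have h1 := frep_gen i (frep_gen j (frep_gen i Mw)).
have h2 := frep_gen j (frep_gen i (frep_gen j Mw)).
by rewrite h1 h2 ji rLMf_braid.
Qed.

Lemma rLM_gen_comm_mul (i j : 'I_n.-1) (M : 'M[laurent]_(rLM_dim n, m)) :
  (i.+1 < j)%N ->
  rLM_gen i *m (rLM_gen j *m M) = rLM_gen j *m (rLM_gen i *m M).
Proof.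
move=> ij; apply/mxcolP => r; apply/matrixP => a b.
have [w Mw] := frep_ex M b.
have h1 := frep_gen i (frep_gen j Mw); have h2 := frep_gen j (frep_gen i Mw).
by rewrite h1 h2 rLMf_comm.
Qed.

End RLMBraid.

Definition rLM_GL (n : nat) (i : 'I_n.-1) : GL laurent (rLM_dim n) :=
  MkGL (rLM_gen_unit i).

Lemma rLM_braid_rel (n : nat) (u v : word 'I_n.-1) :
  braid_rel u v -> eval_word (@rLM_GL n) u = eval_word (@rLM_GL n) v.
Proof.
case=> [i j ji | i j ij]; apply: val_inj => /=.
  exact: rLM_gen_braid_mul.
exact: rLM_gen_comm_mul.
Qed.

Definition rLM (n : nat) :
    representation (braid_group n) laurent (rLM_dim n) :=
  pres_lift (@rLM_braid_rel n).

Lemma rLM_artin (n : nat) (i : 'I_n.-1) : rLM n (artin i) = rLM_GL i.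
Proof. exact: pres_lift_gen. Qed.

(* Main.v *)
Require Import Defs.
From mathcomp Require Import all_boot all_algebra.
From mathcomp Require Import boolp zify ring.

(* Only one property of t and q matters: distinct monomials in t and q take
   distinct values in the algebraic closure. The operator sigma_1 then has the
   simple eigenvalue q^2 t, so a polynomial in sigma_1 is, up to a nonzero
   scalar, the rank one operator w |-> phi(w) v, where v and phi are the right
   and left eigenvectors. An invariant subspace W is either contained in the
   kernel of phi or contains v. In the first case all functionals obtained from
   phi by the action vanish on W; separating eigenvalues of sigma_2 and moving
   along the coordinates and then along the blocks gives every coordinate, so
   W = 0. In the second case separating eigenvalues of sigma_2 puts into W a
   vector supported on the first coordinate of the blocks; there the action is
   of Burau type, and a linear recurrence yields the first basis vector of every
   block; the generators then move these to all basis vectors. *)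

Set Implicit Arguments.
Unset Strict Implicit.
Unset Printing Implicit Defensive.

Import GRing.Theory.
Local Open Scope ring_scope.

(** * The generators as operators on families of coordinates *)

Section Operators.
Variables (L : fieldType) (t q2 : L).
Implicit Types f g h : nat -> nat -> L.

Definition tymf i (f : nat -> L) a : L :=
  if a == i then f i.+1 else if a == i.+1 then t * f i else f a.

Definition etaf i (f : nat -> L) a : L :=
  q2 * (if a == i.+1 then t else 1) * f a.

(* [f r a] is the coordinate [a] of the block [r], both counted from 0; [act i]
   is the action of sigma_(i+1), and [q2] stands for q^2. *)
Definition act i f r a : L :=
  (if r == i then 0 else tymf i (f r) a) +
  (if r.+1 == i then etaf i (tymf i (f i)) a
   else if r == i then - etaf i (tymf i (f i)) a
   else if r == i.+1 then tymf i (f i) a else 0).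

(* Rewriting with these rules avoids the exponential growth of nested [act]
   when the case distinctions are unfolded. *)
Lemma act0E :
  (forall f, act 0 f 0 0 = - q2 * f 0 1) *
  (forall f, act 0 f 0 1 = - q2 * t ^+ 2 * f 0 0) *
  (forall f a, act 0 f 0 a.+2 = - q2 * f 0 a.+2) *
  (forall f, act 0 f 1 0 = f 1 1 + f 0 1) *
  (forall f, act 0 f 1 1 = t * (f 1 0 + f 0 0)) *
  (forall f a, act 0 f 1 a.+2 = f 1 a.+2 + f 0 a.+2) *
  (forall f r, act 0 f r.+2 0 = f r.+2 1) *
  (forall f r, act 0 f r.+2 1 = t * f r.+2 0) *
  (forall f r a, act 0 f r.+2 a.+2 = f r.+2 a.+2).
Proof. by rewrite /act /tymf /etaf /=; do ![split] => *; ring. Qed.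

Lemma act1E :
  (forall f, act 1 f 0 0 = f 0 0 + q2 * f 1 0) *
  (forall f, act 1 f 0 1 = f 0 2 + q2 * f 1 2) *
  (forall f, act 1 f 0 2 = t * f 0 1 + q2 * t ^+ 2 * f 1 1) *
  (forall f a, act 1 f 0 a.+3 = f 0 a.+3 + q2 * f 1 a.+3) *
  (forall f, act 1 f 1 0 = - q2 * f 1 0) *
  (forall f, act 1 f 1 1 = - q2 * f 1 2) *
  (forall f, act 1 f 1 2 = - q2 * t ^+ 2 * f 1 1) *
  (forall f a, act 1 f 1 a.+3 = - q2 * f 1 a.+3) *
  (forall f, act 1 f 2 0 = f 2 0 + f 1 0) *
  (forall f, act 1 f 2 1 = f 2 2 + f 1 2) *
  (forall f, act 1 f 2 2 = t * (f 2 1 + f 1 1)) *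
  (forall f a, act 1 f 2 a.+3 = f 2 a.+3 + f 1 a.+3) *
  (forall f r, act 1 f r.+3 0 = f r.+3 0) *
  (forall f r, act 1 f r.+3 1 = f r.+3 2) *
  (forall f r, act 1 f r.+3 2 = t * f r.+3 1) *
  (forall f r a, act 1 f r.+3 a.+3 = f r.+3 a.+3).
Proof. by rewrite /act /tymf /etaf /=; do ![split] => *; ring. Qed.

(** * Eigenvectors and polynomials in sigma_1 and sigma_2 *)

Definition delta k b (r a : nat) : L := ((r == k) && (a == b))%:R.

Definition shift i c f r a : L := c * f r a + act i f r a.

Definition square_shift i c f r a : L := c * f r a + act i (act i f) r a.

(* Left and right eigenvectors of sigma_1 for the eigenvalue q^2 t. *)
Definition phi f : L := t * f 0 0 - f 0 1.

Definition eigenvec r a : L :=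
  (q2 ^+ 2 * t - 1) * (delta 0 0 r a - t * delta 0 1 r a)
  - (q2 * t - 1) * delta 1 0 r a - t * (1 - q2) * delta 1 1 r a.

(** The factors annihilate the eigenvalues of sigma_1 other than q2 t: the square roots of t, then
    1, -q2 and -q2 t. *)
Definition projector f :=
  square_shift 0 (- t) (shift 0 (-1) (shift 0 q2 (shift 0 (q2 * t) f))).

Lemma projectorE f r a :
  projector f r a = t * (q2 * t - 1) * q2 ^+ 2 * (t + 1) * phi f * eigenvec r a.
Proof.
rewrite /projector /square_shift /shift /phi /eigenvec /delta.
by case: r => [|[|r]]; case: a => [|[|a]]; rewrite !act0E /=; ring.
Qed.

(* On the first two blocks, sigma_2 has eigenvalues 1 and -q^2 on the coordinate
   0, and the square roots of t and of q^4 t^2 on the coordinates 1 and 2. *)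
Definition separator f :=
  square_shift 1 (- (q2 ^+ 2 * t ^+ 2)) (square_shift 1 (- t) f).

Lemma separator00 f : separator f 0 0 =
  (1 - t) * (1 - q2 ^+ 2 * t ^+ 2) * f 0 0 +
  q2 * (1 - q2) * (1 + q2 ^+ 2 - t - q2 ^+ 2 * t ^+ 2) * f 1 0.
Proof. by rewrite /separator /square_shift !act1E; ring. Qed.

Lemma separator01 f : separator f 0 1 = 0.
Proof. by rewrite /separator /square_shift !act1E; ring. Qed.

(** This is (sigma_(i+2) - 1) applied to [delta i.+1 0], a column of reduced Burau type. The
    bracketing fits [act_lin]. *)
Definition burau_col i r a : L :=
  q2 * delta i 0 r a + (- (1 + q2) * delta i.+1 0 r a + delta i.+2 0 r a).

Definition first_coord r a : L :=
  (q2 ^+ 2 * t - 1) * delta 0 0 r a - (q2 * t - 1) * delta 1 0 r a.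

(** Write [separator] as p(sigma_2). The first coefficient is p(1); the second contains the divided
    difference (p(1) - p(-q2)) / (1 + q2). *)
Lemma separator_eigenvec r a : separator eigenvec r a =
  (1 - t) * (1 - q2 ^+ 2 * t ^+ 2) * first_coord r a
  - (q2 * t - 1) * (1 - q2) * (1 + q2 ^+ 2 - t - q2 ^+ 2 * t ^+ 2)
    * burau_col 0 r a.
Proof.
rewrite /separator /square_shift /eigenvec /first_coord /burau_col /delta.
by case: r => [|[|[|r]]]; case: a => [|[|[|a]]]; rewrite !act1E /=; ring.
Qed.

(** The factor sigma_2 - 1 removes the eigenvalue 1, so only the eigenvector for -q2 survives, with
    p(-q2) in its coefficient. *)
Lemma shift_separator_eigenvec r a : shift 1 (-1) (separator eigenvec) r a =
  - (q2 * t - 1) * (q2 ^+ 2 - t) * (q2 ^+ 2 * (1 - t ^+ 2)) * burau_col 0 r a.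
Proof.
rewrite /shift separator_eigenvec.
case: r => [|[|[|r]]]; case: a => [|[|[|a]]];
  rewrite !act1E !separator_eigenvec;
  by rewrite /first_coord /burau_col /delta /=; ring.
Qed.

(** * Linearity and the action on basis families *)

Lemma act_lin i c f g r a :
  act i (fun r a => c * f r a + g r a) r a = c * act i f r a + act i g r a.
Proof. by rewrite /act /tymf /etaf; do ![case: ifP => _]; ring. Qed.

Ltac decide_nat_eqs :=
  repeat match goal with
  | |- context [@eq_op _ ?x ?y] =>
      first [ rewrite (_ : (x == y) = true); last by lia
            | rewrite (_ : (x == y) = false); last by lia
            | case: (eqVneq x y) => ? ]
  end.

Lemma act_delta_fix i k b r a : k <> i -> b <> i -> b <> i.+1 ->
  act i (delta k b) r a = delta k b r a.
Proof.
by move=> ki bi bS; rewrite /act /tymf /etaf /delta; decide_nat_eqs;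
  rewrite /=; ring.
Qed.

Lemma act_delta_up i k r a : k <> i ->
  act i (delta k i) r a = t * delta k i.+1 r a.
Proof.
by move=> ki; rewrite /act /tymf /etaf /delta; decide_nat_eqs; rewrite /=; ring.
Qed.

Lemma act_delta_burau i r a : act i.+1 (delta i.+1 0) r a =
  delta i.+1 0 r a + burau_col i r a.
Proof.
by rewrite /burau_col /act /tymf /etaf /delta; decide_nat_eqs; rewrite /=; ring.
Qed.

Lemma act_delta00 r a :
  act 0 (delta 0 0) r a = - (q2 * t ^+ 2) * delta 0 1 r a + t * delta 1 1 r a.
Proof.
by rewrite /act /tymf /etaf /delta; decide_nat_eqs; rewrite /=; ring.
Qed.

Lemma act_delta_diag i r a : act i.+1 (delta i.+1 i.+1) r a =
  - (q2 * t ^+ 2) * delta i.+1 i.+2 r a +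
  (q2 * t ^+ 2 * delta i i.+2 r a + t * delta i.+2 i.+2 r a).
Proof.
by rewrite /act /tymf /etaf /delta; decide_nat_eqs; rewrite /=; ring.
Qed.

Lemma burau_col_act i r a :
  act i.+2 (burau_col i) r a = burau_col i r a + burau_col i.+1 r a.
Proof.
rewrite /burau_col !act_lin act_delta_burau !act_delta_fix; try by lia.
by rewrite /burau_col; ring.
Qed.

End Operators.

(** * Invariant subspaces as predicates on families *)

Section InvariantFamily.
Variables (L : fieldType) (t q2 : L) (n : nat).
Implicit Types f g h : nat -> nat -> L.

Hypothesis generic : forall a b c d,
  t ^+ a * q2 ^+ b = t ^+ c * q2 ^+ d -> a = c /\ b = d.
Hypothesis n3 : (3 <= n)%N.

Variable P : (nat -> nat -> L) -> Prop.
Hypothesis P_ext : forall f g,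
  (forall r a, (r < n.-1)%N -> (a < n)%N -> f r a = g r a) -> P f -> P g.
Hypothesis P_lin : forall c f g,
  P f -> P g -> P (fun r a => c * f r a + g r a).
Hypothesis P_act : forall i f, (i < n.-1)%N -> P f -> P (act t q2 i f).

(** The equation for [x] lets [ring] recognise a difference of monomials in whatever shape it
    occurs. *)
Lemma generic_neq0 a b c d x : (a != c) || (b != d) ->
  x = t ^+ a * q2 ^+ b - t ^+ c * q2 ^+ d -> x != 0.
Proof.
move=> neq ->; rewrite subr_eq0; apply/negP => /eqP /generic [ac bd].
by move: neq; rewrite ac bd !eqxx.
Qed.

Lemma t_neq0 : t != 0.
Proof.
apply/negP => /eqP t0; suff: (0 : L) != 0 by rewrite eqxx.
(* If t = 0, the distinct monomials t and t^2 coincide. *)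
by apply: (@generic_neq0 1 0 2 0) => //; rewrite t0; ring.
Qed.

Lemma q2_neq0 : q2 != 0.
Proof.
apply/negP => /eqP q0; suff: (0 : L) != 0 by rewrite eqxx.
by apply: (@generic_neq0 0 1 0 2) => //; rewrite q0; ring.
Qed.

Lemma sub1t_neq0 : 1 - t != 0.
Proof. by apply: (@generic_neq0 0 0 1 0) => //; ring. Qed.
Lemma sub1t2_neq0 : 1 - t ^+ 2 != 0.
Proof. by apply: (@generic_neq0 0 0 2 0) => //; ring. Qed.
Lemma sub1q_neq0 : 1 - q2 != 0.
Proof. by apply: (@generic_neq0 0 0 0 1) => //; ring. Qed.
Lemma sub1q2t2_neq0 : 1 - q2 ^+ 2 * t ^+ 2 != 0.
Proof. by apply: (@generic_neq0 0 0 2 2) => //; ring. Qed.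
Lemma subq2t_neq0 : q2 ^+ 2 - t != 0.
Proof. by apply: (@generic_neq0 0 2 1 0) => //; ring. Qed.
Lemma subqt1_neq0 : q2 * t - 1 != 0.
Proof. by apply: (@generic_neq0 1 1 0 0) => //; ring. Qed.
Lemma subqnt1_neq0 : q2 ^+ n * t - 1 != 0.
Proof. by apply: (@generic_neq0 1 n 0 0) => //; ring. Qed.
(** This is not a difference of monomials, but it divides 1 - t^2. *)
Lemma addt1_neq0 : t + 1 != 0.
Proof.
apply: contraNneq sub1t2_neq0 => t1.
by apply/eqP; transitivity ((t + 1) * (1 - t)); [ring | rewrite t1 mul0r].
Qed.

Lemma mull_eq0 (c x : L) : c != 0 -> c * x = 0 -> x = 0.
Proof. by move=> c0 /eqP; rewrite mulf_eq0 (negPf c0) => /eqP. Qed.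

(** No hypothesis puts the zero family into [P]; it arises as f - f from a member. *)
Let P0 f : P f -> P (fun _ _ => 0).
Proof. by move=> Pf; apply: P_ext (P_lin (-1) Pf Pf) => r a _ _; ring. Qed.

Let P_unscale c f g : c != 0 ->
  (forall r a, (r < n.-1)%N -> (a < n)%N -> f r a = c * g r a) -> P f -> P g.
Proof.
move=> c0 fg Pf; apply: P_ext (P_lin c^-1 Pf (P0 Pf)) => r a ltr lta.
by rewrite fg // mulKf // addr0.
Qed.

Let P_shift i c f : (i < n.-1)%N -> P f -> P (shift t q2 i c f).
Proof. by move=> lti Pf; apply: P_lin => //; apply: P_act. Qed.

Let P_square_shift i c f : (i < n.-1)%N -> P f -> P (square_shift t q2 i c f).
Proof. by move=> lti Pf; apply: P_lin => //; do !apply: P_act. Qed.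

Let n1 : (0 < n.-1)%N. Proof. lia. Qed.
Let n2 : (1 < n.-1)%N. Proof. lia. Qed.

Let P_separator f : P f -> P (separator t q2 f).
Proof. by move=> Pf; do !apply: P_square_shift. Qed.

(** * Subspaces inside the kernel of phi *)

Section Kernel.
Hypothesis P_phi : forall f, P f -> phi t f = 0.

Let separator0 f : P f -> separator t q2 f 0 0 = 0.
Proof.
move=> Pf; have := P_phi (P_separator Pf).
by rewrite /phi separator01 subr0; apply: mull_eq0 t_neq0.
Qed.

Let vanish10 f : P f -> f 1 0 = 0.
Proof.
move=> Pf; have := separator0 (P_act n2 Pf); have := separator0 Pf.
rewrite !separator00 !act1E => e0 e1.
(* In the difference of the two equations [f 0 0] cancels; the constant is q2 p(-q2), with p the
   polynomial of [separator]. *)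
apply: (@mull_eq0 (q2 ^+ 3 * (q2 ^+ 2 - t) * (1 - t ^+ 2))).
  by rewrite !mulf_neq0 ?expf_neq0 ?q2_neq0 ?subq2t_neq0 ?sub1t2_neq0.
by rewrite -[RHS](subrr 0) -{1}e1 -e0; ring.
Qed.

Let vanish00 f : P f -> f 0 0 = 0.
Proof.
move=> Pf; have := separator0 Pf.
rewrite separator00 vanish10 // mulr0 addr0; apply: mull_eq0.
by rewrite mulf_neq0 ?sub1t_neq0 ?sub1q2t2_neq0.
Qed.

Let vanish01 f : P f -> f 0 1 = 0.
Proof.
move=> Pf; have /eqP := P_phi Pf.
by rewrite /phi vanish00 // mulr0 sub0r oppr_eq0 => /eqP.
Qed.

Let vanish11 f : P f -> f 1 1 = 0.
Proof.
(* sigma_2^2 brings coordinate 1 back to itself, so only [f 0 1] and [f 1 1] enter. *)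
move=> Pf; have := vanish01 (P_act n2 (P_act n2 Pf)).
rewrite !act1E (vanish01 Pf) => e.
apply: (@mull_eq0 (q2 * t ^+ 2 * (1 - q2))).
  by rewrite !mulf_neq0 ?expf_neq0 ?q2_neq0 ?t_neq0 ?sub1q_neq0.
by rewrite -[RHS]e; ring.
Qed.

Let vanish12 f : P f -> f 1 2 = 0.
Proof.
move=> Pf; have := vanish11 (P_act n2 Pf); rewrite act1E; apply: mull_eq0.
by rewrite oppr_eq0 q2_neq0.
Qed.

Let vanish02 f : P f -> f 0 2 = 0.
Proof.
move=> Pf; have := vanish01 (P_act n2 Pf).
by rewrite act1E vanish12 // mulr0 addr0.
Qed.

Let vanish_block0 a f : P f -> (a < n)%N -> f 0 a = 0.
Proof.
elim: a f => [|a IH] f Pf lt_a; first exact: vanish00.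
case: a => [|[|a]] in IH lt_a *; [exact: vanish01 | exact: vanish02 |].
(* This generator mixes no other block into block 0 and moves coordinate [a.+3] to [a.+2]. *)
have := IH _ (P_act (_ : (a.+2 < n.-1)%N) Pf) (ltnW lt_a).
rewrite /act /tymf /= eqxx addr0; apply; lia.
Qed.

(** Block [r] of [act r.+1 f] is the image of block [r.+1] of f under an injective operator plus a
    term that vanishes by induction. The final cases undo [tymf]. *)
Lemma kernel_trivial f r a : P f -> (r < n.-1)%N -> (a < n)%N -> f r a = 0.
Proof.
elim: r f a => [|r IH] f a Pf lt_r lt_a; first exact: vanish_block0.
have etaf0 b : (b < n)%N -> tymf t r.+1 (f r.+1) b = 0.
  move=> lt_b; have := IH _ b (P_act lt_r Pf) (ltnW lt_r) lt_b.
  have -> : act t q2 r.+1 f r b = etaf t q2 r.+1 (tymf t r.+1 (f r.+1)) b.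
    rewrite /act ltn_eqF // eqxx {1}/tymf !IH ?mulr0 ?if_same ?add0r //; lia.
  rewrite /etaf; apply: mull_eq0; rewrite mulf_neq0 ?q2_neq0 //.
  by case: ifP => _; rewrite ?t_neq0 ?oner_eq0.
have [->|ar] := eqVneq a r.+1.
  have := etaf0 r.+2; rewrite /tymf gtn_eqF // eqxx => h.
  by apply: mull_eq0 t_neq0 (h _); lia.
have [aS|aS] := eqVneq a r.+2.
  by have := etaf0 r.+1; rewrite /tymf eqxx aS; apply; lia.
by have := etaf0 a lt_a; rewrite /tymf (negPf ar) (negPf aS).
Qed.

End Kernel.

(** * Subspaces on which phi does not vanish *)

Section Image.
Hypothesis P_phi : exists2 f, P f & phi t f != 0.

Let P_eigenvec : P (eigenvec t q2).
Proof.
have [f Pf phi_f] := P_phi.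
have Pp : P (projector t q2 f) by do ![apply: P_square_shift | apply: P_shift].
apply: P_unscale (Pp) => [|r a _ _]; last exact: projectorE.
by rewrite !mulf_neq0 ?expf_neq0 ?t_neq0 ?q2_neq0 ?subqt1_neq0 ?addt1_neq0.
Qed.

Let P_zero : P (fun _ _ => 0). Proof. exact: P0 P_eigenvec. Qed.

Let P_scale c f : P f -> P (fun r a => c * f r a).
Proof. by move=> Pf; apply: P_ext (P_lin c Pf P_zero) => r a _ _; ring. Qed.

(** By [burau_col_act], sigma_(i+3) - 1 sends each of these vectors to the next. *)
Let P_burau i : (i.+1 < n.-1)%N -> P (burau_col q2 i).
Proof.
elim: i => [_|i IH lt_i].
  have Ps := P_shift (-1) n2 (P_separator P_eigenvec).
  apply: P_unscale (Ps) => [|r a _ _]; last exact: shift_separator_eigenvec.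
  by rewrite !(mulf_neq0, oppr_eq0) ?expf_neq0 ?q2_neq0 ?subqt1_neq0
    ?subq2t_neq0 ?sub1t2_neq0.
have Pi := IH (ltnW lt_i).
apply: P_ext (P_lin (-1) Pi (P_act lt_i Pi)) => r a _ _.
by rewrite burau_col_act; ring.
Qed.

Let P_first : P (first_coord t q2).
Proof.
have Ps := P_lin
  ((q2 * t - 1) * (1 - q2) * (1 + q2 ^+ 2 - t - q2 ^+ 2 * t ^+ 2))
  (P_burau n2) (P_separator P_eigenvec).
apply: P_unscale (Ps) => [|r a _ _]; last first.
  by rewrite separator_eigenvec addrC subrK.
by rewrite mulf_neq0 ?sub1t_neq0 ?sub1q2t2_neq0.
Qed.

(* Modulo P, the vectors [delta r 0] satisfy a linear recurrence with
   characteristic roots 1 and q2. *)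
Let P_recurrence k : (k < n.-1)%N -> P (fun r a => (1 - q2) * delta L k.+1 0 r a
  - ((q2 ^+ k.+1 - q2) * delta L 0 0 r a + (1 - q2 ^+ k.+1) * delta L 1 0 r a)).
Proof.
(* The recurrence has order two, so two consecutive terms are carried. *)
suff: (k < n.-1)%N -> P (fun r a => (1 - q2) * delta L k 0 r a
      - ((q2 ^+ k - q2) * delta L 0 0 r a + (1 - q2 ^+ k) * delta L 1 0 r a))
   /\ P (fun r a => (1 - q2) * delta L k.+1 0 r a
  - ((q2 ^+ k.+1 - q2) * delta L 0 0 r a + (1 - q2 ^+ k.+1) * delta L 1 0 r a)).
  by move=> h /h[].
elim: k => [_|k IH lt_k].
  by split; apply: P_ext P_zero => r a _ _; ring.
have [Pk Pk1] := IH (ltnW lt_k); split => //.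
have Pb := P_lin (1 - q2) (P_burau lt_k)
  (P_lin (1 + q2) Pk1 (P_scale (- q2) Pk)).
apply: P_ext Pb => r a _ _; rewrite /= /burau_col !exprS; ring.
Qed.

(** Block [n.-1] is out of range, so the recurrence ends in a second relation between [delta 0 0]
    and [delta 1 0]. Eliminating the latter against [first_coord] leaves the coefficient (1 -
    q2)(q2^n t - 1). *)
Let P_delta00 : P (delta L 0 0).
Proof.
have Pn := P_recurrence (_ : (n.-2 < n.-1)%N).
have Pc := P_lin (1 - q2 ^+ n.-1) P_first
  (P_scale (- (q2 * t - 1)) (Pn ltac:(lia))).
have e : n.-2.+1 = n.-1 by lia.
rewrite e in Pc.
apply: P_unscale Pc => [|r a lt_r lt_a].
  exact: mulf_neq0 sub1q_neq0 subqnt1_neq0.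
have -> : q2 ^+ n = q2 ^+ n.-1 * q2 by rewrite -exprSr prednK //; lia.
have -> : delta L n.-1 0 r a = 0 by rewrite /delta ltn_eqF.
by rewrite /first_coord; ring.
Qed.

Let P_delta10 : P (delta L 1 0).
Proof.
have Pc := P_lin (- (q2 ^+ 2 * t - 1)) P_delta00 P_first.
apply: (P_unscale (c := - (q2 * t - 1))) Pc => [|r a _ _].
  by rewrite oppr_eq0 subqt1_neq0.
by rewrite /first_coord; ring.
Qed.

Let P_delta0 k : (k < n.-1)%N -> P (delta L k 0).
Proof.
case: k => [|k] lt_k; first exact: P_delta00.
have Pc := P_lin (1 - q2 ^+ k.+1) P_delta10
  (P_lin (q2 ^+ k.+1 - q2) P_delta00 (P_recurrence (ltnW lt_k))).
by apply: (P_unscale (c := 1 - q2)) Pc => [|r a _ _];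
  [exact: sub1q_neq0 | ring].
Qed.

(** The generator [act b] moves coordinate b to [b.+1] directly in the blocks other than b. In block
    b the image also involves the neighbouring blocks, whose vectors are already available and are
    subtracted. *)
Let P_delta b k : (k < n.-1)%N -> (b < n)%N -> P (delta L k b).
Proof.
elim: b k => [|b IH] k lt_k lt_b; first exact: P_delta0.
have lt_b' : (b < n.-1)%N by lia.
have P_other j : j <> b -> (j < n.-1)%N -> P (delta L j b.+1).
  move=> jb lt_j; have Pj := P_act lt_b' (IH j lt_j (ltnW lt_b)).
  by apply: P_unscale Pj => [|r a _ _]; [exact: t_neq0 | exact: act_delta_up].
have [kb|/eqP kb] := eqVneq k b; last exact: P_other.
have P_next : P (delta L b.+1 b.+1).
  have [lt_b1|ge_b1] := ltnP b.+1 n.-1; first by apply: P_other => //; lia.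
  (* Here block [b.+1] is out of range, so its vector counts as zero. *)
  by apply: P_ext P_zero => r a lt_r _; rewrite /delta ltn_eqF //; lia.
have c0 : - (q2 * t ^+ 2) != 0.
  by rewrite oppr_eq0 mulf_neq0 ?expf_neq0 ?q2_neq0 ?t_neq0.
rewrite {}kb in lt_k *; have Pb := P_act lt_k (IH b lt_k (ltnW lt_b)).
have Pc := P_lin (- t) P_next Pb.
(* Block 0 has no lower neighbour to subtract. *)
case: b => [|b] in lt_k lt_b lt_b' IH P_other P_next c0 Pb Pc *.
  by apply: P_unscale Pc => [|r a _ _]; [exact: c0 | rewrite act_delta00; ring].
have P_prev : P (delta L b b.+2) by apply: P_other; lia.
apply: P_unscale (P_lin (- (q2 * t ^+ 2)) P_prev Pc) => [|r a _ _].
  exact: c0.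
by rewrite act_delta_diag; ring.
Qed.

Let P_sum (I : Type) (s : seq I) (F : I -> nat -> nat -> L) :
  (forall i, P (F i)) -> P (fun r a => \sum_(i <- s) F i r a).
Proof.
move=> PF; elim: s => [|i s IH].
  by apply: P_ext P_zero => r a _ _; rewrite big_nil.
by apply: P_ext (P_lin 1 (PF i) IH) => r a _ _; rewrite big_cons mul1r.
Qed.

Lemma image_full f : P f.
Proof.
have Ps : P (fun r a => \sum_(k < n.-1) \sum_(b < n) f k b * delta L k b r a).
  by apply: P_sum => k; apply: P_sum => b; apply: P_scale; apply: P_delta.
apply: P_ext Ps => r a lt_r lt_a.
rewrite (bigD1 (Ordinal lt_r)) //= [X in _ + X]big1 => [|k kr]; last first.
  apply: big1 => b _; rewrite /delta.
  by rewrite (_ : (r == k) = false) ?mulr0 //; apply/negbTE; rewrite eq_sym.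
rewrite (bigD1 (Ordinal lt_a)) //= big1 => [|b ba].
  by rewrite /delta !eqxx mulr1 !addr0.
by rewrite /delta (_ : (a == b) = false) ?andbF ?mulr0 //;
  apply/negbTE; rewrite eq_sym.
Qed.

End Image.

Lemma invariant_family_trivial :
  (forall f r a, P f -> (r < n.-1)%N -> (a < n)%N -> f r a = 0) \/
  (forall f, P f).
Proof.
have [h|h] := EM (exists2 f, P f & phi t f != 0).
  by right; apply: image_full.
left; apply: kernel_trivial => f Pf.
by apply/eqP/negPn/negP => phi_f; apply: h; exists f.
Qed.

End InvariantFamily.

(** * From matrices over the base-changed ring to families *)

Section BaseChange.
Variables (L : fieldType) (iota : {rmorphism laurent -> L}) (n : nat).

Let t := iota laurent_t.
Let q2 := iota laurent_q ^+ 2.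

Definition block_vector (f : nat -> nat -> L) : 'cV[L]_(rLM_dim n) :=
  \mxcol_(r < n.-1) \col_(a < n) f r a.

Lemma block_vector_eq f g :
  (forall r a, (r < n.-1)%N -> (a < n)%N -> f r a = g r a) ->
  block_vector f = block_vector g.
Proof.
by move=> fg; apply: eq_mxcol => r; apply/colP => a; rewrite !mxE fg.
Qed.

Lemma block_vector_lin c f g :
  block_vector (fun r a => c * f r a + g r a) =
  c *: block_vector f + block_vector g.
Proof.
apply/mxcolP => r; rewrite submxcolD.
have -> : submxcol (c *: block_vector f) r = c *: submxcol (block_vector f) r.
  by apply/matrixP => a b; rewrite !mxE.
by rewrite !mxcolK; apply/colP => a; rewrite !mxE.
Qed.

Lemma block_vector_onto w : exists f, w = block_vector f.
Proof.
exists (fun r a => if (insub r, insub a) is (Some r', Some a')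
                   then submxcol w r' a' 0 else 0).
by apply/mxcolP => r; rewrite mxcolK; apply/colP => a; rewrite !mxE !valK !mxE.
Qed.

(** This serves to read off the rows of [TYM i] and [eta_x] from their products with the identity
    matrix. *)
Lemma sum_map_id (x : 'I_n) (c : laurent) (f : nat -> L) :
  \sum_(j < n) iota (c * (1%:M : 'M[laurent]_n) x j) * f j = iota c * f x.
Proof.
rewrite (bigD1 x) //= big1 => [|j /negPf jx].
  by rewrite mxE eqxx mulr1 addr0.
by rewrite mxE eq_sym jx mulr0 rmorph0 mul0r.
Qed.

Lemma map_TYM_mul (i : 'I_n.-1) (f : nat -> L) :
  map_mx iota (TYM i) *m \col_(a < n) f a = \col_(a < n) tymf t i f a.
Proof.
apply/colP => a; rewrite !mxE /tymf -[TYM i]mulmx1.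
under eq_bigr do rewrite mxE TYM_mulE [X in _ * X]mxE.
case: ifP => _; last case: ifP => _; last first.
- under eq_bigr do rewrite -[1%:M _ _]mul1r.
  by rewrite sum_map_id rmorph1 mul1r.
- exact: sum_map_id.
- under eq_bigr do rewrite -[1%:M _ _]mul1r.
  by rewrite sum_map_id rmorph1 mul1r.
Qed.

Lemma map_eta_x_mul (i : 'I_n.-1) (f : nat -> L) :
  map_mx iota (eta_x (strandS i)) *m \col_(a < n) f a =
  \col_(a < n) etaf t q2 i f a.
Proof.
apply/colP => a; rewrite !mxE /etaf -[eta_x _]mulmx1.
under eq_bigr do rewrite mxE eta_x_mulE [X in _ * X]mxE.
rewrite sum_map_id rmorphM rmorphXn -(inj_eq val_inj) /=.
by case: ifP => _; rewrite ?rmorph1.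
Qed.

Lemma map_mxblock (B : 'I_n.-1 -> 'I_n.-1 -> 'M[laurent]_n) :
  map_mx iota (\mxblock_(r < n.-1, c < n.-1) B r c) =
  \mxblock_(r < n.-1, c < n.-1) map_mx iota (B r c).
Proof. by apply/matrixP => x y; rewrite !mxE. Qed.

Lemma map_rLM_gen_mul (i : 'I_n.-1) f :
  map_mx iota (rLM_gen i) *m block_vector f = block_vector (act t q2 i f).
Proof.
rewrite /rLM_gen map_mxblock mul_mxblock_mxrow; apply: eq_mxcol => r.
(* Block column i yields the second summand of [act], the diagonal blocks the first. *)
rewrite (bigD1 i) //= addrC.
have -> : \col_(a < n) act t q2 i f r a =
    (if r == i then 0 else \col_(a < n) tymf t i (f r) a) +
    (if r.+1 == i :> nat then \col_(a < n) etaf t q2 i (tymf t i (f i)) a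
     else if r == i then - \col_(a < n) etaf t q2 i (tymf t i (f i)) a
     else if r == i.+1 :> nat then \col_(a < n) tymf t i (f i) a else 0).
  apply/colP => a; rewrite !mxE /act -(inj_eq val_inj) /=.
  by congr (_ + _); do ![case: ifP => _]; rewrite !mxE.
congr (_ + _).
  have [->|ri] := eqVneq r i.
    apply: big1 => k /negPf ki.
    by rewrite /rLM_block ki eq_sym ki map_mx0 mul0mx.
  rewrite (bigD1 r) //= big1 ?addr0 => [|k /andP[/negPf ki /negPf kr]].
    by rewrite /rLM_block (negPf ri) eqxx map_TYM_mul.
  by rewrite /rLM_block ki eq_sym kr map_mx0 mul0mx.
rewrite /rLM_block eqxx.
do ![case: ifP => _]; rewrite ?map_mx0 ?mul0mx // ?map_mxN ?map_mxM ?mulNmx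
  -?mulmxA.
- by rewrite map_TYM_mul map_eta_x_mul.
- by rewrite map_TYM_mul map_eta_x_mul.
- by rewrite map_TYM_mul.
Qed.

End BaseChange.

(** * Independence of the monomials, and irreducibility *)

Lemma laurent_monomial_inj a b c d :
  laurent_t ^+ a * laurent_q ^+ b = laurent_t ^+ c * laurent_q ^+ d ->
  a = c /\ b = d.
Proof.
move/(congr1 val); rewrite !rmorphM !rmorphXn /= /frac_t /frac_q.
rewrite -!tofracXn -!tofracM => /eqP; rewrite tofrac_eq -!polyC_exp => /eqP e.
(* The degree in the outer variable gives the exponent of q; after cancelling, the inner degree
   gives that of t. *)
have bd : b = d.
  have := congr1 (fun p : {poly {poly int}} => size p) e.
  by rewrite !size_Cmul ?expf_neq0 ?polyX_eq0 // !size_polyXn => -[].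
split => //; move: e; rewrite bd => /mulIf.
rewrite expf_neq0 ?polyX_eq0 // => /(_ isT)/polyC_inj.
move/(congr1 (fun p : {poly int} => size p)).
by rewrite !size_polyXn => -[].
Qed.

Theorem theorem5p8 (n : nat) (hn3 : (3 <= n)%N) (hn6 : (n <= 6)%N) :
  absolutely_irreducible (rLM n).
Proof.
move=> L iota _; split; first by rewrite rLM_dimE; lia.
pose j : {rmorphism laurent -> L} := iota \o @tofrac laurent.
move=> W W_stable.
(* [W] is pulled back along [block_vector], which is onto, so a statement about all families decides
   [W]. *)
pose P f := block_vector n f \in W.
have generic a b c d : j laurent_t ^+ a * (j laurent_q ^+ 2) ^+ b =
    j laurent_t ^+ c * (j laurent_q ^+ 2) ^+ d -> a = c /\ b = d.
  rewrite -!exprM -!rmorphXn -!rmorphM => /fmorph_inj /eqP.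
  (* The exponents of q are doubled here, hence the halving by [lia]. *)
  by rewrite tofrac_eq => /eqP /laurent_monomial_inj [-> ?]; split; lia.
have P_act i f : (i < n.-1)%N -> P f ->
    P (act (j laurent_t) (j laurent_q ^+ 2) i f).
  move=> lt_i Pf; rewrite /P -(map_rLM_gen_mul j (Ordinal lt_i)).
  by have := W_stable (artin (Ordinal lt_i)) _ Pf; rewrite /= rLM_artin.
have P_ext f g :
    (forall r a, (r < n.-1)%N -> (a < n)%N -> f r a = g r a) -> P f -> P g.
  by move=> /block_vector_eq; rewrite /P => ->.
have P_lin c f g : P f -> P g -> P (fun r a => c * f r a + g r a).
  by move=> Pf Pg; rewrite /P block_vector_lin rpredD ?rpredZ.
have [P0|P1] := invariant_family_trivial generic hn3 P_ext P_lin P_act.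
  left; apply/eqP; rewrite -subv0; apply/subvP => w.
  have [f ->] := block_vector_onto w => Pf; rewrite memv0.
  rewrite (@block_vector_eq L n f (fun _ _ => 0)) => [|r a lt_r lt_a];
    last exact: P0.
  apply/eqP/mxcolP => r; rewrite mxcolK submxcol0.
  by apply/colP => a; rewrite !mxE.
right; apply/vspaceP => w; rewrite memvf.
by have [f ->] := block_vector_onto w; apply: P1.
Qed.
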